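(* If $R$ is a right (resp., left) perfect periodic ring, then the full matrix ring $\mathbb{M}_n(R)$ is periodic for every $n\ge 1$.
   Context: All rings are associative with identity (not necessarily commutative). A ring $R$ is periodic if for every $x\in R$ there exist distinct positive integers $m\neq n$ with $x^m=x^n$. $J(R)$ is the Jacobson radical. A ring $R$ is right perfect if $R/J(R)$ is semisimple (Artinian) and for every sequence $a_1,a_2,\ldots$ of elements of $J(R)$ there is an integer $k\ge 1$ with $a_1a_2\cdots a_k=0$; left perfect is the left-right symmetric notion (with $a_k\cdots a_2a_1=0$). *)

(* Defs.v *)
From HB Require Import structures.
From mathcomp Require Import all_boot all_order all_algebra.
From mathcomp Require Import generic_quotient ring_quotient.
From mathcomp Require Import boolp classical_sets.

Set Implicit Arguments.
Unset Strict Implicit.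
Unset Printing Implicit Defensive.

Import GRing.Theory.
Local Open Scope classical_set_scope.
Local Open Scope ring_scope.
Local Open Scope quotient_scope.

(* Rings are [pzRingType]s: associative, unital, not necessarily commutative,
   with the zero ring allowed. *)

Definition periodic (R : pzRingType) : Prop :=
  forall x : R, exists m n : nat,
    [/\ (0 < m)%N, (0 < n)%N, m <> n & x ^+ m = x ^+ n].

Definition right_ideal (R : pzRingType) (I : set R) : Prop :=
  [/\ I 0,
      forall x y, I x -> I y -> I (x + y) &
      forall x r, I x -> I (x * r)].

Definition maximal_right_ideal (R : pzRingType) (M : set R) : Prop :=
  [/\ right_ideal M,
      M <> [set: R] &
      forall K, right_ideal K -> M `<=` K -> K = M \/ K = [set: R]].

Definition jacobson (R : pzRingType) : set R :=
  \bigcap_(M in [set M | maximal_right_ideal M]) M.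
Arguments jacobson : clear implicits.

Lemma right_idealN (R : pzRingType) (I : set R) x :
  right_ideal I -> I x -> I (- x).
Proof. by move=> [_ _ IM] Ix; rewrite -mulrN1; apply: IM. Qed.

Lemma right_idealB (R : pzRingType) (I : set R) x y :
  right_ideal I -> I x -> I y -> I (x - y).
Proof.
by move=> rI Ix Iy; have [_ ID _] := rI; apply: ID => //; apply: right_idealN.
Qed.

Lemma jacobson_right_ideal (R : pzRingType) : right_ideal (jacobson R).
Proof.
split=> [M [[M0 _ _] _ _] //|x y Jx Jy M mM|x r Jx M mM].
  by have [[_ MD _] _ _] := mM; apply: MD; [apply: Jx|apply: Jy].
by have [[_ _ MM] _ _] := mM; apply: MM; apply: Jx.
Qed.

(* For M a maximal right ideal and r \notin M, the right ideal
   {y | r * y \in M} is again maximal. *)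
Lemma jacobsonMl (R : pzRingType) (r x : R) :
  jacobson R x -> jacobson R (r * x).
Proof.
move=> Jx M mM; have [rM MnT Mmax] := mM; have [M0 MD MM] := rM.
have [Mr|nMr] := pselect (M r); first exact: MM.
pose N : set R := [set y | M (r * y)].
suff mN : maximal_right_ideal N by exact: (Jx N mN).
split.
- split=> [|y z Ny Nz|y z Ny]; rewrite /N /=.
  + by rewrite mulr0.
  + by rewrite mulrDr; apply: MD.
  + by rewrite mulrA; apply: MM.
- by move=> NT; apply: nMr; have : N 1 by [rewrite NT]; rewrite /N /= mulr1.
move=> K rK NK; have [K0 KD KM] := rK.
have [KN|] := pselect (K `<=` N); first by left; apply/seteqP.
move=> /existsNP[k /not_implyP[Kk nNk]]; right.
pose L : set R := [set z | exists m s, M m /\ z = m + r * (k * s)].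
have rL : right_ideal L.
  split=> [|_ _ [m [s [Mm ->]]] [m' [s' [Mm' ->]]]|_ t [m [s [Mm ->]]]].
  - by exists 0, 0; split => //; rewrite !mulr0 addr0.
  - exists (m + m'), (s + s'); split; first exact: MD.
    by rewrite !mulrDr addrACA.
  - by exists (m * t), (s * t); split; [exact: MM|rewrite mulrDl !mulrA].
have ML : M `<=` L by move=> m Mm; exists m, 0; rewrite !mulr0 addr0.
have [LM|LT] := Mmax L rL ML.
  have Lrk : L (r * k) by exists 0, 1; rewrite mulr1 add0r.
  by case: nNk; rewrite LM in Lrk.
apply/seteqP; split=> // y _.
have [m [s [Mm E]]] : L (r * y) by rewrite LT.
have Ks : K (k * s) by exact: KM.
rewrite -(subrK (k * s) y); apply: KD => //; apply: NK.
by rewrite /N /= mulrBr E addrK.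
Qed.

Section JacobsonQuotient.
Context (R : pzRingType).

Definition jacobsonb : {pred R} := fun x => `[< jacobson R x >].

Lemma jacobsonbP x : reflect (jacobson R x) (x \in jacobsonb).
Proof. exact: asboolP. Qed.

Lemma jacobsonb_zmod_closed : zmod_closed jacobsonb.
Proof.
have rJ := jacobson_right_ideal R; split; first by apply/jacobsonbP; case: rJ.
by move=> x y /jacobsonbP Jx /jacobsonbP Jy; apply/jacobsonbP; exact: (right_idealB rJ).
Qed.

HB.instance Definition _ :=
  GRing.isZmodClosed.Build R jacobsonb jacobsonb_zmod_closed.

(* The library only equips quotients of commutative rings with a ring
   structure, so the multiplication of R / J(R) is defined here on top of the
   library's quotient of additive groups. *)
Definition jquot : Type := Quotient.quot jacobsonb.
HB.instance Definition _ := GRing.Zmodule.on jquot.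
HB.instance Definition _ := Quotient.on jquot.

Definition jproj (x : R) : jquot := \pi_(Quotient.quot jacobsonb) x.

Lemma jproj_surj (a : jquot) : exists x, jproj x = a.
Proof. by exists (repr a); rewrite /jproj reprK. Qed.

Lemma jproj_eq x y : jproj x = jproj y <-> jacobson R (x - y).
Proof.
split=> [/eqP|/jacobsonbP]; rewrite /jproj.
  by rewrite -Quotient.idealrBE => /jacobsonbP.
by rewrite Quotient.idealrBE => /eqP.
Qed.

Lemma jproj_is_zmod_morphism : zmod_morphism jproj.
Proof. by move=> x y; rewrite /jproj raddfB. Qed.

HB.instance Definition _ :=
  GRing.isZmodMorphism.Build R jquot jproj jproj_is_zmod_morphism.

Definition jone : jquot := jproj 1.
Definition jmul (a b : jquot) : jquot := jproj (repr a * repr b).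

Lemma jmulE x y : jmul (jproj x) (jproj y) = jproj (x * y).
Proof.
have [_ JD JM] := jacobson_right_ideal R.
have rep z : jacobson R (repr (jproj z) - z).
  by apply/jproj_eq; rewrite {1}/jproj reprK.
apply/jproj_eq; set x' := repr (jproj x); set y' := repr (jproj y).
have -> : x' * y' - x * y = (x' - x) * y' + x * (y' - y).
  by rewrite mulrBl mulrBr addrA subrK.
by apply: JD; [apply: JM; apply: rep|apply: jacobsonMl; apply: rep].
Qed.

Lemma jmulA : associative jmul.
Proof.
move=> a b c; have [x <-] := jproj_surj a; have [y <-] := jproj_surj b.
by have [z <-] := jproj_surj c; rewrite !jmulE mulrA.
Qed.

Lemma jmul1l : left_id jone jmul.
Proof. by move=> a; have [x <-] := jproj_surj a; rewrite jmulE mul1r. Qed.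

Lemma jmul1r : right_id jone jmul.
Proof. by move=> a; have [x <-] := jproj_surj a; rewrite jmulE mulr1. Qed.

Lemma jmulDl : left_distributive jmul +%R.
Proof.
move=> a b c; have [x <-] := jproj_surj a; have [y <-] := jproj_surj b.
by have [z <-] := jproj_surj c; rewrite -raddfD !jmulE -raddfD mulrDl.
Qed.

Lemma jmulDr : right_distributive jmul +%R.
Proof.
move=> a b c; have [x <-] := jproj_surj a; have [y <-] := jproj_surj b.
by have [z <-] := jproj_surj c; rewrite -raddfD !jmulE -raddfD mulrDr.
Qed.

HB.instance Definition _ :=
  GRing.Zmodule_isPzRing.Build jquot jmulA jmul1l jmul1r jmulDl jmulDr.

Lemma jproj_is_monoid_morphism : monoid_morphism jproj.
Proof. by split=> // x y; rewrite -jmulE. Qed.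

HB.instance Definition _ :=
  GRing.isMonoidMorphism.Build R jquot jproj jproj_is_monoid_morphism.

End JacobsonQuotient.

(* Every submodule of the right regular module is a direct summand; this
   already entails that S is Artinian. *)
Definition semisimple_ring (S : pzRingType) : Prop :=
  forall I : set S, right_ideal I ->
    exists K : set S,
      [/\ right_ideal K,
          I `&` K = [set 0] &
          forall x, exists y z, [/\ I y, K z & x = y + z]].

Definition right_T_nilpotent (R : pzRingType) (I : set R) : Prop :=
  forall a : nat -> R, (forall i, I (a i)) ->
    exists k, (0 < k)%N /\ \prod_(i < k) a i = 0.

(* The product is a_(k-1) * ... * a_1 * a_0. *)
Definition left_T_nilpotent (R : pzRingType) (I : set R) : Prop :=
  forall a : nat -> R, (forall i, I (a i)) ->
    exists k, (0 < k)%N /\ \prod_(i < k) a (rev_ord i) = 0.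

(* Both the Jacobson radical and semisimplicity are left-right symmetric, so
   the two sides differ only in the order of the products. *)
Definition right_perfect (R : pzRingType) : Prop :=
  semisimple_ring (jquot R) /\ right_T_nilpotent (jacobson R).

Definition left_perfect (R : pzRingType) : Prop :=
  semisimple_ring (jquot R) /\ left_T_nilpotent (jacobson R).

(* Main.v *)
(** Since the integers generate a finite subring of a periodic ring, it suffices
to find, for each matrix [A], exponents [k < m] with [A^m - A^k] nilpotent: [A]
then satisfies a monic polynomial over some [Z/q], so it has finitely many
powers.  T-nilpotence of [J = J(R)] makes every matrix over [J] nilpotent by
Koenig's lemma, so the problem moves to matrices over [S = R/J].

There, local finiteness (finite sets lie in finite subrings) passes from the two
corners [eSe] and [fSf] of orthogonal idempotents to [(e+f)S(e+f)], hence from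
[S] to its matrix rings.  By semisimplicity [1] is a finite sum of orthogonal
idempotents whose corners are periodic division rings; these are commutative by
Jacobson's theorem (through Wedderburn's little theorem), hence locally finite. *)

From HB Require Import structures.
Require Import Defs.
From mathcomp Require Import all_boot all_order all_algebra all_field.
From mathcomp Require Import boolp classical_sets cardinality.

Set Implicit Arguments.
Unset Strict Implicit.
Unset Printing Implicit Defensive.

Import GRing.Theory.
Local Open Scope classical_set_scope.
Local Open Scope ring_scope.

(* No unit is required, so that corners [e R e] qualify. *)
Definition subrng (R : pzRingType) (F : set R) : Prop :=
  (forall x y, F x -> F y -> F (x - y)) /\
  (forall x y, F x -> F y -> F (x * y)).

Definition finite_exponent (R : pzRingType) : Prop :=
  exists2 q, (0 < q)%N & forall x : R, x *+ q = 0.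

(** The finite subrng [F] may leave [C]; when [C] is itself a subrng, intersecting with [C] repairs
    this. *)
Definition locally_finite (R : pzRingType) (C : set R) : Prop :=
  forall X : set R, finite_set X -> X `<=` C ->
    exists F, [/\ finite_set F, X `<=` F & subrng F].

(** For idempotent [e] this is [eRe], encoded by fixed points so that membership is an equation. *)
Definition corner (R : pzRingType) (e : R) : set R := [set x | e * x * e = x].

(** * Finite rings and local finiteness *)

Section Span.
Context (R : pzRingType).
Implicit Types (s : seq R) (x y : R).

(* Natural coefficients suffice in a ring of finite exponent. *)
Definition zspan s : set R :=
  range (fun c : {ffun 'I_(size s) -> nat} => \sum_(i < size s) s`_i *+ c i).

Lemma zspanD s x y : zspan s x -> zspan s y -> zspan s (x + y).
Proof.
move=> [c _ <-] [d _ <-]; exists [ffun i => (c i + d i)%N] => //.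
by rewrite -big_split; apply: eq_bigr => i _; rewrite ffunE mulrnDr.
Qed.

Lemma zspan0 s : zspan s 0.
Proof.
exists [ffun => 0%N] => //.
by rewrite big1 // => i _; rewrite ffunE mulr0n.
Qed.

Lemma zspanMn s x n : zspan s x -> zspan s (x *+ n).
Proof.
move=> sx; elim: n => [|n IH]; first by rewrite mulr0n; apply: zspan0.
by rewrite mulrS; apply: zspanD.
Qed.

Lemma zspan_mem s x : x \in s -> zspan s x.
Proof.
move=> xs; have lt_i : (index x s < size s)%N by rewrite index_mem.
exists [ffun j => (j == Ordinal lt_i) : nat] => //.
rewrite (bigD1 (Ordinal lt_i)) //= big1 ?addr0 => [|j /negPf nj].
  by rewrite ffunE eqxx mulr1n nth_index.
by rewrite ffunE nj.
Qed.

Lemma zspan_min s (C : set R) :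
    C 0 -> (forall x y, C x -> C y -> C (x + y)) -> {in s, forall x, C x} ->
  zspan s `<=` C.
Proof.
move=> C0 CD sC _ [c _ <-]; apply: big_ind => // i _.
elim: (c i) => [|n IH]; first by rewrite mulr0n.
by rewrite mulrS; apply: CD => //; apply: sC; apply: mem_nth.
Qed.

Lemma zspanN s x : finite_exponent R -> zspan s x -> zspan s (- x).
Proof.
move=> [[//|q] _ q0] sx; suff <- : x *+ q = - x by apply: zspanMn.
by apply/eqP; rewrite -addr_eq0 -mulrSr q0.
Qed.

(** Coefficients only matter modulo the exponent of [R]. *)
Lemma finite_zspan s : finite_exponent R -> finite_set (zspan s).
Proof.
move=> [[//|q] _ q0].
apply: (@sub_finite_set _ _
  (range (fun c : {ffun 'I_(size s) -> 'I_q.+1} => \sum_(i < size s) s`_i *+ c i))).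
  move=> _ [c _ <-]; exists [ffun i => inord (c i %% q.+1)] => //.
  apply: eq_bigr => i _; rewrite ffunE inordK ?ltn_mod //.
  by rewrite {2}(divn_eq (c i) q.+1) mulrnDr mulrnA q0 add0r.
by apply: finite_image; apply: finite_finset.
Qed.

End Span.

(** By bilinearity the additive span of [G] is closed under products. Local finiteness thus reduces
    to finding finite multiplicatively closed sets. *)
Lemma finite_mulclosed_subrng (R : pzRingType) (G : set R) :
    finite_exponent R -> finite_set G ->
    (forall x y, G x -> G y -> G (x * y)) ->
  exists F, [/\ finite_set F, G `<=` F & subrng F].
Proof.
move=> q0 /finite_seqP[s ->] sM; exists (zspan s); split.
- exact: finite_zspan.
- by move=> x; apply: zspan_mem.
split=> [x y sx sy|x y sx sy]; first by apply: zspanD => //; apply: zspanN.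
apply: (@zspan_min _ s [set x | zspan s (x * y)]) sx => [|a b|a sa] /=.
- by rewrite mul0r; apply: zspan0.
- by rewrite mulrDl; apply: zspanD.
apply: (@zspan_min _ s [set y | zspan s (a * y)]) sy => [|b c|b sb] /=.
- by rewrite mulr0; apply: zspan0.
- by rewrite mulrDr; apply: zspanD.
- by apply: zspan_mem; apply: sM.
Qed.

Lemma subrng0 (R : pzRingType) (F : set R) x : subrng F -> F x -> F 0.
Proof. by move=> [FB _] Fx; rewrite -(subrr x); apply: FB. Qed.

Lemma subrngN (R : pzRingType) (F : set R) x : subrng F -> F x -> F (- x).
Proof.
by move=> sF Fx; rewrite -sub0r; apply: sF.1 => //; apply: subrng0 Fx.
Qed.

Lemma subrngD (R : pzRingType) (F : set R) x y :
  subrng F -> F x -> F y -> F (x + y).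
Proof.
by move=> sF Fx Fy; rewrite -[y]opprK; apply: sF.1 => //; apply: subrngN.
Qed.

Lemma corner_subrng (R : pzRingType) (e : R) : e * e = e -> subrng (corner e).
Proof.
move=> ee; split=> x y; rewrite /corner /= => ex ey.
  by rewrite mulrBr mulrBl ex ey.
by rewrite -{1}ex -{1}ey -!mulrA ee !mulrA ee -(mulrA e x) -mulrA -[in RHS]ex
  -[in RHS]ey !mulrA -(mulrA _ e e) ee.
Qed.

Lemma locally_finiteS (R : pzRingType) (C : set R) (X : set R) :
    subrng C -> locally_finite C -> finite_set X -> X `<=` C ->
  exists F, [/\ finite_set F, X `<=` F, F `<=` C & subrng F].
Proof.
move=> sC lC fX XC; have [F [fF XF sF]] := lC X fX XC.
exists (F `&` C); split=> [|x Xx|x []//|].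
- exact: finite_setIl.
- by split; [apply: XF|apply: XC].
- by split=> x y [Fx Cx] [Fy Cy]; split; [apply: sF.1|apply: sC.1
    |apply: sF.2|apply: sC.2].
Qed.

(** Preimages of [X] are chosen and enclosed in a finite subrng. [f] need not preserve [1], so
    embeddings of corners qualify. *)
Lemma locally_finite_image (R S : pzRingType) (f : R -> S) (C : set S) :
    zmod_morphism f -> {morph f : x y / x * y} -> C `<=` range f ->
    locally_finite [set: R] -> locally_finite C.
Proof.
move=> fB fM Cf lR X fX XC.
have /choice[g gK] : forall y, exists x, C y -> f x = y.
  move=> y; have [/Cf[x _ <-]|nC] := pselect (C y); first by exists x.
  by exists 0.
have [//|F [fF XF sF]] := lR (g @` X) (finite_image g fX).
exists (f @` F); split.
- exact: finite_image.
- by move=> y Xy; exists (g y); [apply: XF; exists y|apply: gK; apply: XC].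
- split=> _ _ [x Fx <-] [y Fy <-].
    by exists (x - y); [apply: sF.1|rewrite fB].
  by exists (x * y); [apply: sF.2|rewrite fM].
Qed.

(** * Powers in periodic rings *)

Lemma periodic_ltn (R : pzRingType) (x : R) : periodic R ->
  exists m n, [/\ (0 < m)%N, (m < n)%N & x ^+ m = x ^+ n].
Proof.
move=> /(_ x)[m [n [m0 n0 /eqP]]]; rewrite neq_ltn => /orP[lt_mn E|lt_nm E].
  by exists m, n.
by exists n, m.
Qed.

Lemma finite_powers (R : pzRingType) (x : R) (m n : nat) :
  (m < n)%N -> x ^+ m = x ^+ n -> finite_set (range (fun i => x ^+ i)).
Proof.
move=> lt_mn E; apply: (@sub_finite_set _ _ ((fun i => x ^+ i) @` `I_n)).
  move=> _ [i _ <-]; elim/ltn_ind: i => i IH.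
  have [lt_in|le_ni] := ltnP i n; first by exists i.
  have -> : x ^+ i = x ^+ (m + (i - n))%N.
    by rewrite -{1}(subnKC le_ni) !exprD E.
  by apply: IH; rewrite -{2}(subnKC le_ni) ltn_add2r.
by apply: finite_image; apply: finite_II.
Qed.

Lemma finite_powers_periodic (R : pzRingType) (x : R) (F : set R) :
    finite_set F -> (forall i, F (x ^+ i.+1)) ->
  exists m n, [/\ (0 < m)%N, (0 < n)%N, m <> n & x ^+ m = x ^+ n].
Proof.
move=> fF Fx; apply: contrapT => noper; apply: infinite_nat.
apply: sub_finite_set (finite_preimage (f := fun i => x ^+ i.+1) _ fF) => [i _|].
  exact: Fx.
move=> i j _ _ E; apply: contrapT => nij; apply: noper.
by exists i.+1, j.+1; split=> // -[].
Qed.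

(** Periodicity of the single element [2] already gives [2 ^ n - 2 ^ m = 0] in [R]. *)
Lemma periodic_exponent (R : pzRingType) : periodic R -> finite_exponent R.
Proof.
move=> /(periodic_ltn 2%:R)[m [n [m0 lt_mn E]]].
have le2 : (2 ^ m < 2 ^ n)%N by rewrite ltn_exp2l.
exists (2 ^ n - 2 ^ m)%N => [|x]; first by rewrite subn_gt0.
by rewrite -mulr_natl natrB ?(ltnW le2) // !natrX E subrr mul0r.
Qed.

(** * Gluing corners *)

(* With [V] a finite subrng of the second corner and [U] one of the first that
   also contains [e X f V f X e], the products [l u r] with [l] in
   [e + V f X e] and [r] in [e + e X f V] form, together with [V], a
   multiplicatively closed finite set: [r l'] always falls back into [U]. *)
Lemma locally_finite_cornerD (R : pzRingType) (e f : R) :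
    finite_exponent R -> e * e = e -> f * f = f -> e * f = 0 -> f * e = 0 ->
    locally_finite (corner e) -> locally_finite (corner f) ->
  locally_finite (corner (e + f)).
Proof.
move=> q0 ee ff ef fe le lf X fX XC.
pose pX a b : set R := (fun x => a * x * b) @` X.
have fpX a b : finite_set (pX a b) by exact: finite_image.
have [||V [fV XV VC sV]] := locally_finiteS (corner_subrng ff) lf (X := f |` pX f f).
- by rewrite finite_setU; split=> //; apply: finite_set1.
- by move=> _ [->|[x _ <-]]; rewrite /corner /= ?ff // !mulrA ff -mulrA ff.
have Vf : V f by apply: XV; left.
have Vl v : V v -> f * v = v.
  by move=> /VC vC; rewrite -[in LHS]vC !mulrA ff vC.
have Vr v : V v -> v * f = v.
  by move=> /VC vC; rewrite -[in LHS]vC -!mulrA ff mulrA vC.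
have V0 : V 0 by exact: subrng0 sV Vf.
(* These are the products [(e x f v) (f y e)] that arise when an element of [K] meets one of [L]. *)
pose P : set R := [set a * b | a in [set x * v | x in pX e f & v in V] & b in pX f e].
have [||U [fU XU UC sU]] :=
    locally_finiteS (corner_subrng ee) le (X := e |` (pX e e `|` P)).
- rewrite !finite_setU; split; first exact: finite_set1.
  by split=> //; do 2 apply: finite_image2 => //.
- move=> _ [->|[[x _ <-]|[_ [_ [x _ <-] [v Vv <-]] [_ [y _ <-] <-]]]];
    by rewrite /corner /= ?ee // !mulrA ee -!mulrA ee.
have Ue : U e by apply: XU; left.
have UP x v y : X x -> V v -> X y -> U (e * x * f * v * (f * y * e)).
  move=> Xx Vv Xy; apply: XU; right; right; exists (e * x * f * v); last first.
    by exists (f * y * e) => //; exists y.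
  by exists (e * x * f); [exists x|exists v].
have Ul u : U u -> e * u = u.
  by move=> /UC uC; rewrite -[in LHS]uC !mulrA ee uC.
have Ur u : U u -> u * e = u.
  by move=> /UC uC; rewrite -[in LHS]uC -!mulrA ee mulrA uC.
have U0 : U 0 by exact: subrng0 sU Ue.
pose L : set R := e |` [set v * x | v in V & x in pX f e].
pose K : set R := e |` [set x * v | x in pX e f & v in V].
pose LUK : set R := [set x * k | x in [set l * u | l in L & u in U] & k in K].
have LUK_intro l u k : L l -> U u -> K k -> LUK (l * u * k).
  by move=> Ll Uu Kk; exists (l * u); [exists l => //; exists u|exists k].
(* Zero is needed for the mixed products in which [e] meets an element of [V]. *)
have LUK0 : LUK 0.
  by rewrite -(mul0r e) -(mulr0 e); apply: LUK_intro => //; left.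
have Le : L e by left.
have Ke : K e by left.
have Lv v x : V v -> X x -> L (v * (f * x * e)).
  by move=> Vv Xx; right; exists v => //; exists (f * x * e) => //; exists x.
have Kv v x : V v -> X x -> K (e * x * f * v).
  by move=> Vv Xx; right; exists (e * x * f); [exists x|exists v].
have ve v : V v -> v * e = 0 by move=> Vv; rewrite -(Vr v Vv) -mulrA fe mulr0.
have ev v : V v -> e * v = 0 by move=> Vv; rewrite -(Vl v Vv) mulrA ef mul0r.
have KL k l : K k -> L l -> U (k * l).
  move=> [->|[_ [x Xx <-] [v Vv <-]]] [->|[w Vw [_ [y Xy <-] <-]]].
  - by rewrite ee.
  - by rewrite mulrA ev // mul0r.
  - by rewrite -mulrA ve // mulr0.
  - have -> : e * x * f * v * (w * (f * y * e)) =
        e * x * f * (v * w) * (f * y * e) by rewrite !mulrA.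
    by apply: UP => //; apply: sV.2.
have [||F [fF GF sF]] := @finite_mulclosed_subrng R (V `|` LUK) q0.
- rewrite finite_setU; split=> //; apply: finite_image2.
    apply: finite_image2 => //; rewrite finite_setU; split; first exact: finite_set1.
    exact: finite_image2.
  rewrite finite_setU; split; first exact: finite_set1.
  exact: finite_image2.
- move=> x y [Vx|[_ [l Ll [u Uu <-] [k Kk <-]]]]
    [Vy|[_ [l' Ll' [u' Uu' <-] [k' Kk' <-]]]].
  + by left; apply: sV.2.
  + right; case: Ll' => [->|[v Vv [_ [z Xz <-] <-]]].
      by rewrite !mulrA ve // !mul0r.
    have -> : x * (v * (f * z * e) * u' * k') = x * v * (f * z * e) * u' * k'.
      by rewrite !mulrA.
    by apply: LUK_intro => //; apply: Lv => //; apply: sV.2.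
  + right; case: Kk => [->|[_ [z Xz <-] [v Vv <-]]].
      by rewrite -mulrA ev // mulr0.
    have -> : l * u * (e * z * f * v) * y = l * u * (e * z * f * (v * y)).
      by rewrite !mulrA.
    by apply: LUK_intro => //; apply: Kv => //; apply: sV.2.
  + right; have -> : l * u * k * (l' * u' * k') = l * (u * (k * l' * u')) * k'.
      by rewrite !mulrA.
    by apply: LUK_intro => //; apply: sU.2 => //; apply: sU.2 => //; apply: KL.
exists F; split=> // x Xx.
(* Peirce decomposition: the last piece lies in [V], the other three in [LUK]. *)
have -> : x = e * x * e + e * x * f + f * x * e + f * x * f.
  have xE : (e + f) * x * (e + f) = x := XC x Xx.
  by rewrite -{1}xE mulrDl mulrDl !mulrDr addrA.
do 3 ?[apply: subrngD => //]; apply: GF.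
- right; have Ux : U (e * x * e) by apply: XU; right; left; exists x.
  by rewrite -(Ur _ Ux) -(Ul _ Ux); apply: LUK_intro.
- right; have -> : e * x * f = e * e * (e * x * f * f).
    by rewrite ee -(mulrA _ f) ff !mulrA ee.
  by apply: LUK_intro => //; apply: Kv.
- right; have -> : f * x * e = f * (f * x * e) * e * e.
    by rewrite -(mulrA _ e) ee !mulrA ff -(mulrA _ e) ee.
  by apply: LUK_intro => //; apply: Lv.
- by left; apply: XV; right; exists x.
Qed.

(** * Orthogonal sums of idempotents and matrix rings *)

Lemma locally_finite_corner0 (R : pzRingType) : locally_finite (corner (0 : R)).
Proof.
move=> X _ X0; exists [set 0]; split; first exact: finite_set1.
  by move=> x /X0; rewrite /corner /= mulr0 => <-.
by split=> x y /= -> ->; rewrite ?subrr ?mulr0.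
Qed.

(** Partial sums are idempotent and orthogonal to the remaining [u i], so corners are glued one at a
    time. *)
Lemma locally_finite_corner_sum (R : pzRingType) (I : eqType) (s : seq I)
    (u : I -> R) :
    finite_exponent R -> uniq s ->
    (forall i j, u i * u j = if i == j then u i else 0) ->
    (forall i, locally_finite (corner (u i))) ->
  locally_finite (corner (\sum_(i <- s) u i)).
Proof.
move=> q0 us uM lu; pose e t := \sum_(i <- t) u i.
have eu t i : uniq t -> e t * u i = if i \in t then u i else 0.
  rewrite /e; elim: t => [|j t IH] /=; first by rewrite big_nil mul0r.
  move=> /andP[jt ut]; rewrite big_cons mulrDl uM IH // in_cons eq_sym.
  by case: eqVneq jt => [->|_] /=; [move=> /negPf->; rewrite addr0|rewrite add0r].
have ue t i : uniq t -> u i * e t = if i \in t then u i else 0.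
  rewrite /e; elim: t => [|j t IH] /=; first by rewrite big_nil mulr0.
  move=> /andP[jt ut]; rewrite big_cons mulrDr uM IH // in_cons.
  by case: eqVneq jt => [->|_] /=; [move=> /negPf->; rewrite addr0|rewrite add0r].
have ee t : uniq t -> e t * e t = e t.
  move=> ut; rewrite {2}/e mulr_sumr [RHS]big_seq big_seq.
  by apply: eq_bigr => i it; rewrite eu ?it.
elim: s us => [|i s IH] /=; first by rewrite big_nil => _; apply: locally_finite_corner0.
move=> /andP[/negPf nis us]; rewrite big_cons; apply: locally_finite_cornerD => //.
- by rewrite uM eqxx.
- exact: ee.
- by rewrite ue // nis.
- by rewrite eu // nis.
- exact: IH.
Qed.

Lemma corner1 (R : pzRingType) : corner (1 : R) = setT.
Proof. by apply/seteqP; split=> // x _; rewrite /corner /= mul1r mulr1. Qed.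

Lemma finite_exponent_mx (R : pzRingType) (n : nat) :
  finite_exponent R -> finite_exponent 'M[R]_n.
Proof.
move=> [q q0 qR]; exists q => // A; apply/matrixP => i j.
by rewrite !mxE mulmxnE qR.
Qed.

(** The diagonal matrix units are orthogonal idempotents with sum [1], and each of their corners is
    a copy of [R]. *)
Lemma locally_finite_mx (R : pzRingType) (n : nat) :
    finite_exponent R -> locally_finite [set: R] ->
  locally_finite [set: 'M[R]_n].
Proof.
move=> q0 lR; rewrite -corner1.
have -> : 1 = \sum_(i <- index_enum 'I_n) delta_mx i i :> 'M[R]_n by exact: mx1_sum_delta.
apply: locally_finite_corner_sum.
- exact: finite_exponent_mx.
- exact: index_enum_uniq.
- move=> i j; case: eqVneq => [->|nij]; first by rewrite [LHS]mul_delta_mx.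
  by rewrite [LHS]mul_delta_mx_0.
move=> i; apply: (@locally_finite_image _ _ (fun a => a *: delta_mx i i)) => //.
- by move=> a b; rewrite scalerBl.
- move=> a b; apply/matrixP=> k l; rewrite !mxE (bigD1 i) //= big1 ?addr0 => [|j nji].
    by rewrite !mxE !eqxx !andbT; case: (k == i) => /=; case: (l == i);
      rewrite ?(mulr0, mulr1, mul0r).
  by rewrite !mxE (negPf nji) andbF !(mulr0, mul0r).
move=> A; rewrite /corner /= => <-; exists (A i i) => //.
apply/matrixP=> k l; rewrite !mxE (bigD1 i) //= !mxE (bigD1 i) //= !mxE !eqxx /=.
rewrite !big1 ?addr0 => [|j nji|j nji].
- rewrite !andbT; case: (k == i) => /=; case: (l == i);
      by rewrite ?(mulr0, mulr1, mul0r, mul1r).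
- by rewrite !mxE (negPf nji) ?andbF !(mulr0, mul0r).
- by rewrite !mxE (negPf nji) ?andbF !(mulr0, mul0r).
Qed.

(** * Local finiteness and periodicity *)

Lemma locally_finite_periodic (R : pzRingType) :
  locally_finite [set: R] -> periodic R.
Proof.
move=> lR x; have [|//|F [fF xF sF]] := lR [set x]; first exact: finite_set1.
apply: (finite_powers_periodic fF) => i; elim: i => [|i IH]; first exact: xF.
by rewrite exprS; apply: sF.2 => //; apply: xF.
Qed.

(** Generators are adjoined one by one: multiplying a finite closed set by the finitely many powers
    of [x] keeps it finite and, by commutativity, closed. *)
Lemma locally_finite_commutative (D : pzRingType) :
  periodic D -> commutative (@GRing.mul D) -> locally_finite [set: D].
Proof.
move=> pD mC X /finite_seqP[s ->] _.
suff [G [fG sG G1 GM]] : exists G : set D, [/\ finite_set G, [set` s] `<=` G, G 1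
    & forall x y, G x -> G y -> G (x * y)].
  have [F [fF GF sF]] := finite_mulclosed_subrng (periodic_exponent pD) fG GM.
  by exists F; split=> //; apply: subset_trans GF.
elim: s => [|x s [G [fG sG G1 GM]]].
  by exists [set 1]; split=> // _ _ -> ->; rewrite /= mulr1.
exists [set y * g | y in range (fun i => x ^+ i) & g in G]; split.
- apply: finite_image2 => //; have [m [n [_ lt_mn E]]] := periodic_ltn x pD.
  exact: finite_powers lt_mn E.
- move=> y /=; rewrite in_cons => /orP[/eqP->|ys].
    by exists x; [exists 1%N|exists 1; rewrite ?mulr1].
  by exists 1; [exists 0%N|exists y; rewrite ?mul1r //; apply: sG].
- by exists 1; [exists 0%N|exists 1; rewrite ?mulr1].
- move=> _ _ [_ [i _ <-] [g Gg <-]] [_ [j _ <-] [h Gh <-]].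
  exists (x ^+ (i + j)); first by exists (i + j)%N.
  exists (g * h); first exact: GM.
  by rewrite exprD -!mulrA; congr (_ * _); rewrite !mulrA (mC g).
Qed.

(** * Periodic domains are commutative *)

Section FiniteDomain.
Context (D : pzRingType) (s : seq D).

Definition in_seq : {pred D} := fun x => x \in s.

Hypothesis s_subring : subring_closed in_seq.
Hypothesis oneD : (1 : D) != 0.
Hypothesis domD : forall x y : D, x * y = 0 -> x = 0 \/ y = 0.

(** A finite subring is packaged as a finite ring type, to which Wedderburn's little theorem
    [finDomain_mulrC] applies. *)
Definition seq_subring : Type := seq_sub s.

HB.instance Definition _ := Finite.on seq_subring.
HB.instance Definition _ : @isSub D in_seq seq_subring := SubType.on seq_subring.
HB.instance Definition _ :=
  GRing.SubChoice_isSubPzRing.Build D in_seq seq_subring s_subring.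
HB.instance Definition _ := GRing.PzSemiRing_isNonZero.Build seq_subring oneD.
HB.instance Definition _ := FinRing.isNzRing.Build seq_subring.

Lemma seq_subring_commute x y : x \in s -> y \in s -> x * y = y * x.
Proof.
move=> xs ys.
have dom : GRing.integral_domain_axiom seq_subring.
  move=> u v /(congr1 val) /= /domD[u0|v0]; apply/orP.
    by left; apply/eqP/val_inj.
  by right; apply/eqP/val_inj.
have /(congr1 val) := finDomain_mulrC dom (SeqSub xs : seq_subring) (SeqSub ys).
exact.
Qed.

End FiniteDomain.

Definition domain (D : pzRingType) : Prop :=
  (1 : D) <> 0 /\ forall x y : D, x * y = 0 -> x = 0 \/ y = 0.

Lemma finite_subrng_commute (D : pzRingType) (F : set D) (x y : D) :
    domain D -> finite_set F -> F 1 -> subrng F -> F x -> F y ->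
  x * y = y * x.
Proof.
move=> [/eqP D1 domD] /finite_seqP[s Fs] F1 [FB FM] Fx Fy.
rewrite {F}Fs in F1 FB FM Fx Fy.
by apply: (seq_subring_commute (s := s)).
Qed.

Lemma domain_expr_eq0 (D : pzRingType) (x : D) n :
  domain D -> x ^+ n = 0 -> x = 0.
Proof.
move=> [D1 domD]; elim: n => [|n IH]; first by rewrite expr0 => /D1.
by rewrite exprS => /domD[|/IH].
Qed.

Lemma periodic_domain_order (D : pzRingType) (x : D) :
  domain D -> periodic D -> x <> 0 -> exists2 N, (0 < N)%N & x ^+ N = 1.
Proof.
move=> dD pD x0; have [m [n [_ lt_mn E]]] := periodic_ltn x pD.
exists (n - m)%N; first by rewrite subn_gt0.
have /dD.2[/(domain_expr_eq0 dD)//|/eqP] : x ^+ m * (x ^+ (n - m) - 1) = 0.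
  by rewrite mulrBr mulr1 -exprD subnKC ?(ltnW lt_mn) // E subrr.
by rewrite subr_eq0 => /eqP.
Qed.

(** Otherwise [D] has prime characteristic [q] with [N = m q], and Frobenius turns [x ^+ N = 1] into
    [(x ^+ m - 1) ^+ q = 0], so [x ^+ m = 1] against the minimality of [N]. *)
Lemma domain_order_natr_neq0 (D : pzRingType) (x : D) (N : nat) :
    domain D -> (0 < N)%N -> x ^+ N = 1 ->
    (forall k, (0 < k)%N -> x ^+ k = 1 -> (N <= k)%N) ->
  N%:R <> 0 :> D.
Proof.
move=> dD N0 xN Nmin ND0; have [D1 domD] := dD.
have exq : exists q, (0 < q)%N && ((q%:R : D) == 0) by exists N; rewrite N0 ND0 eqxx.
case: (ex_minnP exq) => q /andP[q0 /eqP qD0] qmin.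
have q_dvd k : (k%:R : D) = 0 -> (q %| k)%N.
  rewrite {1}(divn_eq k q) natrD natrM qD0 mulr0 add0r => kq0.
  rewrite /dvdn; apply: contraT; rewrite -lt0n => kq.
  by have := qmin (k %% q)%N; rewrite kq kq0 eqxx leqNgt ltn_mod q0 => /(_ isT).
have prq : prime q.
  have q1 : (1 < q)%N.
    rewrite ltn_neqAle q0 andbT; apply/eqP => q1; apply: D1.
    by rewrite -qD0 -q1.
  apply/primeP; split=> // d /dvdnP[k qkd].
  have /domD[/q_dvd|/q_dvd] : (k%:R : D) * d%:R = 0 by rewrite -natrM -qkd.
    move=> qk; have k0 : (0 < k)%N by case: (k) qkd q0 => // ->.
    apply/orP; left; have := dvdn_leq k0 qk; rewrite qkd.
    have d0 : (0 < d)%N by case: (d) qkd q0 => //; rewrite muln0 => ->.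
    by rewrite -{2}(muln1 k) leq_pmul2l // eqn_leq d0 andbT.
  by move=> qd; apply/orP; right; rewrite eqn_dvd qd andbT qkd dvdn_mull.
have /dvdnP[m Nmq] := q_dvd N ND0.
case: q q0 qD0 prq Nmq {qmin q_dvd exq} => // q _ qD0 prq Nmq.
have m0 : (0 < m)%N by case: (m) Nmq N0 => // ->.
suff /Nmin : x ^+ m = 1.
  by move=> /(_ m0); rewrite Nmq -{2}(muln1 m) leq_pmul2l // leqNgt prime_gt1.
apply/eqP; rewrite -subr_eq0; apply/eqP.
set z := x ^+ m - 1; apply: (@domain_expr_eq0 _ _ q.+1) => //.
have : (1 + z) ^+ q.+1 = 1 by rewrite addrC subrK -exprM -Nmq.
rewrite (exprDn_comm _ (commr_sym (commr1 z))) big_ord_recr big_ord_recl /=.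
rewrite subnn !expr0 mul1r mulr1 subn0 expr1n bin0 binn !mulr1n.
rewrite big1 ?addr0 => [/(congr1 (fun t => t - 1))|i _].
  by rewrite addrAC subrr add0r.
(* The inner binomial coefficients vanish, being divisible by the characteristic. *)
have /dvdnP[k ->] : (q.+1 %| 'C(q.+1, bump 0 i))%N.
  by apply: prime_dvd_bin => //; rewrite /bump /= add1n ltnS.
by rewrite mulrnA -mulr_natr qD0 mulr0.
Qed.

(* Discrete Fourier transform of [c] along the cyclic group of [a]: the [b i]
   satisfy [b i a = a^i b i] by telescoping and add up to [N c a^(N-1)], so if
   [c] does not commute with [a], some [b i] conjugates [a] to [a^i != a]. *)
Lemma exists_conjugating (D : pzRingType) (a c : D) :
    domain D -> periodic D -> a * c <> c * a ->
  exists b i, [/\ b <> 0, b * a = a ^+ i * b & a ^+ i <> a].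
Proof.
move=> dD pD ac; have [D1 domD] := dD.
have a0 : a <> 0 by move=> a0; apply: ac; rewrite a0 mul0r mulr0.
have exN : exists N, (0 < N)%N && (a ^+ N == 1).
  by have [N N0 aN] := periodic_domain_order dD pD a0; exists N; rewrite N0 aN eqxx.
case: (ex_minnP exN) => N /andP[N0 /eqP aN] Nmin {exN}.
have NminP k : (0 < k)%N -> a ^+ k = 1 -> (N <= k)%N.
  by move=> k0 ak; apply: Nmin; rewrite k0 ak eqxx.
have ND := domain_order_natr_neq0 dD N0 aN NminP.
pose b i := \sum_(0 <= j < N) a ^+ (i * (N.-1 - j)) * c * a ^+ j.
have ba i : b i * a = a ^+ i * b i.
  apply/eqP; rewrite -subr_eq0 mulr_suml mulr_sumr -sumrB.
  (* The two ends of the telescope, [T N] and [T 0], agree because [a ^+ N = 1]. *)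
  pose T j := a ^+ (i * (N - j)) * c * a ^+ j.
  rewrite (eq_big_nat _ _ (F2 := fun j => T j.+1 - T j)) => [|j /andP[_ jN]].
    rewrite telescope_sumr // /T subnn subn0 muln0 mulnC exprM aN expr1n !expr0.
    by rewrite mulr1 mul1r subrr.
  congr (_ - _); rewrite /T.
    by rewrite -mulrA -exprSr -predn_sub -subnS.
  rewrite !mulrA -exprD -mulnS; congr (a ^+ (i * _) * c * _).
  by case: (N) jN => // k; rewrite ltnS => /subSn.
have bsum : \sum_(i < N) b i = c * a ^+ N.-1 *+ N.
  have -> : \sum_(i < N) b i =
      \sum_(0 <= j < N) (\sum_(i < N) (a ^+ (N.-1 - j)) ^+ i) * c * a ^+ j.
    rewrite exchange_big /=; apply: eq_bigr => j _; rewrite !mulr_suml.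
    by apply: eq_bigr => i _; rewrite mulnC exprM.
  (* Only [j = N - 1] survives: for smaller [j] the inner geometric sum has ratio [y] with
     [y ^+ N = 1] and [y] distinct from [1]. *)
  rewrite -{1}(prednK N0) big_nat_recr //= big_nat big1 ?add0r => [|j /andP[_ jN]].
    rewrite subnn expr0 (eq_bigr (fun=> 1)) => [|i _]; last by rewrite expr1n.
    by rewrite sumr_const card_ord !mulr_natl mulrnAl.
  set y := a ^+ _.
  have yN : y ^+ N = 1 by rewrite -exprM mulnC exprM aN expr1n.
  have : (y - 1) * \sum_(i < N) y ^+ i = 0 by rewrite -subrX1 yN subrr.
  move=> /domD[/eqP|->]; last by rewrite !mul0r.
  rewrite subr_eq0 => /eqP y1; have := NminP (N.-1 - j)%N _ y1.
  rewrite subn_gt0 jN => /(_ isT); rewrite leqNgt => /negP[].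
  by rewrite (leq_ltn_trans (leq_subr _ _)) // ltn_predL.
apply: contrapT => nob.
have bcomm i : a * b i = b i * a.
  rewrite ba; have [->|b0] := pselect (b i = 0); first by rewrite !mulr0.
  have [->//|ai] := pselect (a ^+ i = a).
  by case: nob; exists (b i), i.
have : a * (\sum_(i < N) b i) = (\sum_(i < N) b i) * a.
  by rewrite mulr_sumr mulr_suml; apply: eq_bigr.
rewrite bsum mulrnAr mulrnAl -!mulrA -exprSr (prednK N0) aN mulr1 !mulrA => /eqP.
rewrite -subr_eq0 -mulrnBl -mulr_natl => /eqP/domD[//|/eqP].
rewrite subr_eq0 => /eqP E; apply: ac.
by rewrite -[in RHS]E -mulrA -exprSr (prednK N0) aN mulr1.
Qed.

(** A noncommuting pair would yield [b] with [b a = a^i b] distinct from [a b]. The products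
    [a^j b^k] are then finite in number and closed under multiplication, so [a] and [b] lie in a
    finite domain and commute. *)
Lemma periodic_domain_commutative (D : pzRingType) :
  domain D -> periodic D -> commutative (@GRing.mul D).
Proof.
move=> dD pD a c; apply: contrapT => /(exists_conjugating dD pD)[b [i [b0 ba ai]]].
have baj j k : exists l, b ^+ k * a ^+ j = a ^+ l * b ^+ k.
  elim: k j => [|k IH] j; first by exists j; rewrite mul1r mulr1.
  have bj : b * a ^+ j = a ^+ (i * j) * b.
    elim: j => [|j IHj]; first by rewrite muln0 mul1r mulr1.
    by rewrite exprSr mulrA IHj -mulrA ba mulrA -exprD mulnSr.
  have [l kl] := IH (i * j)%N; exists l.
  by rewrite exprSr -mulrA bj mulrA kl mulrA.
pose G : set D :=
  [set x * y | x in range (fun j => a ^+ j) & y in range (fun k => b ^+ k)].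
have fpow (x : D) : finite_set (range (fun j => x ^+ j)).
  by have [m [n [_ lt_mn E]]] := periodic_ltn x pD; exact: finite_powers lt_mn E.
have [||F [fF GF sF]] := @finite_mulclosed_subrng D G (periodic_exponent pD).
- exact: finite_image2.
- move=> _ _ [_ [j _ <-] [_ [k _ <-] <-]] [_ [j' _ <-] [_ [k' _ <-] <-]].
  have [l kl] := baj j' k; exists (a ^+ (j + l)); first by exists (j + l)%N.
  exists (b ^+ (k + k')); first by exists (k + k')%N.
  by rewrite !exprD -!mulrA; congr (_ * _); rewrite !mulrA kl.
have Gjk j k : F (a ^+ j * b ^+ k).
  by apply: GF; exists (a ^+ j); [exists j|exists (b ^+ k); [exists k|]].
have : b * a = a * b.
  apply: (finite_subrng_commute dD fF) => //.
  - by have := Gjk 0%N 0%N; rewrite mulr1.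
  - by have := Gjk 0%N 1%N; rewrite mul1r.
  - by have := Gjk 1%N 0%N; rewrite mulr1.
rewrite ba => /eqP; rewrite -subr_eq0 -mulrBl => /eqP/dD.2[/eqP|//].
by rewrite subr_eq0 => /eqP.
Qed.

(** * Corner rings and semisimple rings *)

Section CornerRing.
Context (R : pzRingType) (e : R).

Definition cornerb : {pred R} := fun x => e * x * e == x.

Hypothesis ee : e * e = e.

(** The proof of idempotence is a parameter of the type, so that the ring instance, which needs it,
    can recover it. *)
Definition corner_ring_of of e * e = e : Type := {x | cornerb x}.
Notation corner_ring := (corner_ring_of ee).

Lemma cornerb_zmod_closed : zmod_closed cornerb.
Proof.
split=> [|x y /eqP ex /eqP ey]; first by rewrite unfold_in mulr0 mul0r.
by rewrite unfold_in mulrBr mulrBl ex ey.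
Qed.

HB.instance Definition _ := SubChoice.on corner_ring.
HB.instance Definition _ :=
  GRing.SubChoice_isSubZmodule.Build R cornerb corner_ring cornerb_zmod_closed.

Lemma corner_one_subproof : cornerb e.
Proof. by rewrite /cornerb ee ee. Qed.

Definition corner_one : corner_ring := exist _ e corner_one_subproof.

Lemma corner_mul_subproof (x y : corner_ring) : cornerb (val x * val y).
Proof.
apply/eqP; have [_ CM] := corner_subrng ee.
exact: CM (eqP (valP x)) (eqP (valP y)).
Qed.

Definition corner_mul (x y : corner_ring) : corner_ring :=
  exist _ (val x * val y) (corner_mul_subproof x y).

Lemma corner_mulA : associative corner_mul.
Proof. by move=> x y z; apply: val_inj; rewrite /= mulrA. Qed.

Lemma corner_mul1l : left_id corner_one corner_mul.
Proof.
by move=> x; apply: val_inj; rewrite /= -(eqP (valP x)) !mulrA ee.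
Qed.

Lemma corner_mul1r : right_id corner_one corner_mul.
Proof.
by move=> x; apply: val_inj; rewrite /= -(eqP (valP x)) -!mulrA ee.
Qed.

Lemma corner_mulDl : left_distributive corner_mul +%R.
Proof. by move=> x y z; apply: val_inj; rewrite /= mulrDl. Qed.

Lemma corner_mulDr : right_distributive corner_mul +%R.
Proof. by move=> x y z; apply: val_inj; rewrite /= mulrDr. Qed.

HB.instance Definition _ := GRing.Zmodule_isPzRing.Build corner_ring
  corner_mulA corner_mul1l corner_mul1r corner_mulDl corner_mulDr.

(** Exponents are positive because the zeroth power is [e] in the corner but [1] in [R]. *)
Lemma val_corner_exp (x : corner_ring) n : val (x ^+ n.+1) = val x ^+ n.+1.
Proof. by elim: n => [|n IH] //; rewrite exprS [RHS]exprS -IH. Qed.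

Lemma corner_ring_periodic : periodic R -> periodic corner_ring.
Proof.
move=> pR x; have [[|m] [[|n] [// _ _ nmn E]]] := pR (val x).
by exists m.+1, n.+1; split=> //; apply: val_inj; rewrite !val_corner_exp.
Qed.

Lemma locally_finite_corner :
  locally_finite [set: corner_ring] -> locally_finite (corner e).
Proof.
apply: (@locally_finite_image _ _ (val : corner_ring -> R)) => // x /eqP ex.
by exists (exist _ x ex).
Qed.

(* If [x z x = x] and [x != 0], then [e z x] is a nonzero idempotent, hence
   the unit [e], so [x y = 0] forces [y = e z x y = 0]. *)
Lemma corner_ring_domain : e <> 0 ->
    (forall x : R, exists y, x * y * x = x) ->
    (forall f, corner e f -> f * f = f -> f = 0 \/ f = e) ->
  domain corner_ring.
Proof.
move=> e0 reg prim; split=> [/(congr1 val)//|x y xy0].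
have [x0|x0] := pselect (x = 0); [by left|right].
have [z] := reg (val x); set x' := val x => xzx.
have xE : e * x' * e = x' := eqP (valP x).
have ex : e * x' = x' by rewrite -xE !mulrA ee.
have xe : x' * e = x' by rewrite -xE -!mulrA ee.
have [|||zx0] := prim (e * z * x').
- by rewrite /corner /= !mulrA ee -mulrA xe.
- by rewrite -!mulrA (mulrA x') xe (mulrA x') xzx.
- move=> zx0; case: x0; apply: val_inj.
  by rewrite [LHS]/= -/x' -xzx -{1}xe -!mulrA (mulrA e) zx0 mulr0.
apply: val_inj; rewrite -[y]mul1r [LHS]/= -zx0 -mulrA.
by rewrite -[x' * _]/(val (x * y)) xy0 mulr0.
Qed.

End CornerRing.

(** Write [1 = x r + k] with [k] in a complement [K] of [xS]; then [k x = x (1 - r x)] lies in both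
    [K] and [xS], hence vanishes. *)
Lemma semisimple_regular (S : pzRingType) :
  semisimple_ring S -> forall x : S, exists y, x * y * x = x.
Proof.
move=> ssS x; pose I : set S := range (fun r => x * r).
have [|K [[_ _ KM] IK0 /(_ 1)[_ [k [[r _ <-] Kk E]]]]] := ssS I.
  split=> [|_ _ [r _ <-] [s _ <-]|_ s [r _ <-]].
  - by exists 0; rewrite ?mulr0.
  - by exists (r + s); rewrite ?mulrDr.
  - by exists (r * s); rewrite ?mulrA.
exists r; suff kx : k * x = 0 by rewrite -[RHS]mul1r E mulrDl kx addr0.
suff : (I `&` K) (k * x) by rewrite IK0.
split; last exact: KM.
exists (1 - r * x) => //.
by rewrite mulrBr mulr1 -{1}[x]mul1r E mulrDl mulrA addrC addKr.
Qed.

(* Were [1] bad, one could peel off nonzero idempotents [e k - e k.+1] for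
   ever; a complement of the right ideal of the [x] killed by some [e n]
   provides a single [n] that kills all of it, contradicting
   [e n (1 - e n.+1) != 0]. *)
Lemma semisimple_periodic_locally_finite (S : pzRingType) :
  semisimple_ring S -> periodic S -> locally_finite [set: S].
Proof.
move=> ssS pS; pose bad (e : S) := e * e = e /\ ~ locally_finite (corner e).
rewrite -corner1; apply: contrapT => bad1.
have split_bad e : exists e', bad e -> [/\ bad e', corner e e' & e' <> e].
  have [[ee nle]|nbe] := pselect (bad e); last by exists 0.
  have e0 : e <> 0 by move=> e0; apply: nle; rewrite e0; apply: locally_finite_corner0.
  (* Without a proper bad idempotent below [e], gluing leaves only [0] and [e] as idempotents of the
     corner, which is then a domain by regularity, hence commutative and locally finite. *)
  apply: contrapT => noe'; apply: nle.
  apply: (@locally_finite_corner _ _ ee).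
  have pC : periodic (corner_ring_of ee) := corner_ring_periodic pS.
  apply: locally_finite_commutative => //.
  apply: periodic_domain_commutative => //.
  apply: corner_ring_domain => //; first exact: semisimple_regular.
  move=> f ef ff; apply: contrapT => /not_orP[f0 fe].
  have Cef : corner e (e - f).
    by apply: (corner_subrng ee).1 => //; rewrite /corner /= ee ee.
  have eMf : e * f = f by rewrite -ef !mulrA ee.
  have fMe : f * e = f by rewrite -ef -!mulrA ee.
  have efef : (e - f) * (e - f) = e - f.
    by rewrite mulrBl !mulrBr ee eMf fMe ff subrr subr0.
  have lf : locally_finite (corner f).
    by apply: contrapT => nlf; apply: noe'; exists f.
  have lef : locally_finite (corner (e - f)).
    apply: contrapT => nlf; apply: noe'; exists (e - f) => _; split=> //.
    by move/eqP; rewrite subr_eq addrC -subr_eq subrr eq_sym => /eqP.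
  (* The witness [e] is formal: its premise [bad e] is refuted by gluing the corners of [f] and
     [e - f]. *)
  case: (noe'); exists e => -[_ []].
  rewrite -[e](subrKC f); apply: locally_finite_cornerD => //.
  - exact: periodic_exponent.
  - by rewrite mulrBr fMe ff subrr.
  - by rewrite mulrBl eMf ff subrr.
have [next nextP] := choice split_bad.
pose e n := iter n next 1.
have bad_e n : bad (e n).
  by elim: n => [|n IH]; [split=> //; rewrite mulr1|have [] := nextP _ IH].
have ee n : e n * e n = e n by have [] := bad_e n.
have [Ce ne] : (forall n, corner (e n) (e n.+1)) /\ (forall n, e n.+1 <> e n).
  by split=> n; have [] := nextP _ (bad_e n).
have eS n : e n.+1 * e n = e n.+1 by rewrite -(Ce n) -!mulrA ee.
have Se n : e n * e n.+1 = e n.+1 by rewrite -(Ce n) !mulrA ee.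
pose I : set S := [set x | exists n, e n * x = 0].
have eD n k x : e n * x = 0 -> e (n + k)%N * x = 0.
  move=> ex; elim: k => [|k IH]; first by rewrite addn0.
  by rewrite addnS -eS -mulrA IH mulr0.
have rI : right_ideal I.
  split=> [|x y [n nx] [k ky]|x r [n nx]].
  - by exists 0%N; rewrite mulr0.
  - by exists (n + k)%N; rewrite mulrDr eD // addnC eD // addr0.
  - by exists n; rewrite mulrA nx mul0r.
have [K [[_ _ KM] IK0 /(_ 1)[i [k [Ii Kk E]]]]] := ssS I rI.
(* The component [i] of [1] in [I] is a left identity on [I], so any [e n] that kills [i] kills all
   of [I]. *)
have iI x : I x -> i * x = x.
  move=> Ix; suff kx : k * x = 0 by rewrite -[RHS]mul1r E mulrDl kx addr0.
  suff : (I `&` K) (k * x) by rewrite IK0.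
  split; last exact: KM.
  have -> : k * x = x + i * - x.
    by rewrite mulrN -{2}[x]mul1r E mulrDl addrAC subrr add0r.
  have [_ ID IM] := rI; apply: ID => //; exact: IM.
have [n ni] := Ii.
apply: (ne n); apply/esym/eqP; rewrite -subr_eq0 -(Se n) -{1}[e n]mulr1 -mulrBr.
rewrite -(iI (1 - e n.+1)) ?mulrA ?ni ?mul0r //.
by exists n.+1; rewrite mulrBr mulr1 ee subrr.
Qed.

(** * Nilpotent matrices and lifting *)

(* Koenig's lemma: if no power of [A] vanishes, some infinite path
   [i_0, i_1, ...] has all products [A i_0 i_1 * ... * A i_(k-1) i_k] nonzero. *)
Lemma right_T_nilpotent_mx (R : pzRingType) (n : nat) (I : set R) (A : 'M[R]_n) :
  right_T_nilpotent I -> (forall i j, I (A i j)) -> exists k, A ^+ k = 0.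
Proof.
move=> tI AI; apply: contrapT => nA.
(* A pair is a partial path, given by its product and last vertex; the bad ones extend to nonzero
   products of every length. *)
pose bad (p : R * 'I_n) := forall k, exists j, p.1 * (A ^+ k) p.2 j <> 0.
have step p : exists l, bad p -> bad (p.1 * A p.2 l, l).
  have [bp|nbp] := pselect (bad p); last by exists p.2.
  apply: contrapT => nol.
  have /choice[K KP] l : exists k, forall j, p.1 * A p.2 l * (A ^+ k) l j = 0.
    apply: contrapT => nok; apply: nol; exists l => _ k.
    apply: contrapT => nj; apply: nok; exists k => j.
    by apply: contrapT => ?; apply: nj; exists j.
  (* One factor moves to a successor [l], and the maximum of the [K l] then kills every branch. *)
  have [j] := bp (\max_l K l).+1; rewrite exprS mxE mulr_sumr; apply.
  apply: big1 => l _; rewrite -(subnKC (leq_bigmax l : (K l <= _)%N)) exprD.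
  rewrite mulrA mxE mulr_sumr big1 // => m _.
  by rewrite mulrA KP mul0r.
have [next nextP] := choice step.
have [i bad1] : exists i, bad (1, i).
  apply: contrapT => noi; apply: nA.
  have /choice[K KP] i : exists k, forall j, (A ^+ k) i j = 0.
    apply: contrapT => nok; apply: noi; exists i => k.
    apply: contrapT => nj; apply: nok; exists k => j.
    by apply: contrapT => ?; apply: nj; exists j; rewrite mul1r.
  exists (\max_i K i)%N; apply/matrixP => l j; rewrite mxE.
  rewrite -(subnKC (leq_bigmax l : (K l <= _)%N)) exprD mxE big1 // => m _.
  by rewrite KP mul0r.
pose path k := iter k (fun p => (p.1 * A p.2 (next p), next p)) (1, i).
have bad_path k : bad (path k) by elim: k => [//|k IH]; apply: nextP.
have pathE k : (path k).1 = \prod_(m < k) A (path m).2 (path m.+1).2.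
  by elim: k => [|k IH]; rewrite ?big_ord0 // big_ord_recr /= -IH.
have [k [_ pk0]] := tI _ (fun m => AI (path m).2 (path m.+1).2).
(* Badness at exponent [0] says that the path product itself is nonzero. *)
by have [j] := bad_path k 0%N; rewrite pathE pk0 mul0r.
Qed.

Lemma left_T_nilpotent_converse (R : pzRingType) (I : set R) :
  left_T_nilpotent I -> @right_T_nilpotent R^c I.
Proof.
move=> tI a aI; have [k [k0 ak]] := tI a aI; exists k; split=> //.
rewrite -[RHS]ak; elim: k {k0 ak} => [|k IH]; first by rewrite !big_ord0.
rewrite big_ord_recr [RHS]big_ord_recl IH /= subn1; congr (_ * _).
Qed.

(** Transposition reverses products once the entries are read in the converse ring [R^c], where the
    right-handed case applies. *)
Lemma left_T_nilpotent_mx (R : pzRingType) (n : nat) (I : set R) (A : 'M[R]_n) :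
  left_T_nilpotent I -> (forall i j, I (A i j)) -> exists k, A ^+ k = 0.
Proof.
move=> /left_T_nilpotent_converse tI AI.
have [|k Ak] := @right_T_nilpotent_mx R^c n I A^T tI.
  by move=> i j; rewrite mxE.
exists k; apply: trmx_inj; rewrite trmx0 -[RHS]Ak.
elim: k {Ak} => [|k IH]; first by rewrite trmx1.
by rewrite exprSr [RHS]exprS -IH [LHS]trmx_mul_rev.
Qed.

(* [A ^+ (m * N)] is an integral combination of lower powers, so the additive
   group they span is a finite ring. *)
Lemma periodic_of_nilpotent_sub (R : pzRingType) (x : R) (m k N : nat) :
    finite_exponent R -> (k < m)%N -> (x ^+ m - x ^+ k) ^+ N = 0 ->
  exists m n, [/\ (0 < m)%N, (0 < n)%N, m <> n & x ^+ m = x ^+ n].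
Proof.
move=> q0 km xN.
pose V d := zspan [seq x ^+ i | i <- iota 0 d].
have VX d i : (i < d)%N -> V d (x ^+ i).
  by move=> id; apply: zspan_mem; apply: map_f; rewrite mem_iota.
have Vmin d (C : set R) : C 0 -> (forall y z, C y -> C z -> C (y + z)) ->
    (forall i, (i < d)%N -> C (x ^+ i)) -> V d `<=` C.
  move=> C0 CD CX; apply: zspan_min => // y /mapP[i].
  by rewrite mem_iota => /andP[_ id] ->; apply: CX.
have VM d e y : V d y -> V (d + e)%N (y * x ^+ e).
  apply: (Vmin d [set y | V (d + e)%N (y * x ^+ e)]) => [|a b|i id] /=.
  - by rewrite mul0r; apply: zspan0.
  - by rewrite mulrDl; apply: zspanD.
  - by rewrite -exprD; apply: VX; rewrite ltn_add2r.
have VS d e : (d <= e)%N -> V d `<=` V e.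
  move=> de; apply: Vmin => [|y z|i id]; [exact: zspan0|exact: zspanD|].
  by apply: VX; apply: leq_trans de.
have VB d y z : V d y -> V d z -> V d (y - z).
  by move=> Vy Vz; apply: zspanD => //; apply: zspanN.
(* As [k < m], expanding the [N]-th power leaves [x ^+ (m * N)] plus lower powers only. *)
have : V (m * N)%N (x ^+ (m * N) - (x ^+ m - x ^+ k) ^+ N).
  elim: N {xN} => [|N IH]; first by rewrite muln0 subrr; apply: zspan0.
  rewrite exprSr; set h := _ ^+ N in IH *.
  have -> : x ^+ (m * N.+1) - h * (x ^+ m - x ^+ k) =
      (x ^+ (m * N) - h) * x ^+ m + h * x ^+ k.
    by rewrite mulrBr mulrBl -exprD mulnSr opprB addrA addrAC.
  rewrite mulnSr; apply: zspanD; first exact: VM.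
  have -> : h = x ^+ (m * N) - (x ^+ (m * N) - h) by rewrite subKr.
  rewrite mulrBl; apply: VB; first by rewrite -exprD; apply: VX; rewrite ltn_add2l.
  by apply: (VS (m * N + k)%N); [rewrite leq_add2l ltnW|apply: VM].
rewrite xN subr0; move: (m * N)%N => d Vd.
apply: (@finite_powers_periodic _ _ (V d)); first exact: finite_zspan.
suff Vx i : V d (x ^+ i) by [].
have [/VX//|di] := ltnP i d.
(* Since [x ^+ d] lies in [V d], multiplication by [x] preserves [V d]. *)
rewrite -(subnK di); elim: (i - d)%N => // {di} {}i.
rewrite addSn exprSr; apply: (Vmin d [set y | V d (y * x)]) => [|a b|j] /=.
- by rewrite mul0r; apply: zspan0.
- by rewrite mulrDl; apply: zspanD.
- by rewrite -exprSr leq_eqVlt => /orP[/eqP->|/VX].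
Qed.

(** Periodicity over [R/J] puts the entries of some [A ^+ m - A ^+ k] in [J]. The nilpotence
    hypothesis isolates the only step where the left and right cases differ. *)
Lemma periodic_mx_of_nil_jacobson (R : pzRingType) (n : nat) :
    semisimple_ring (jquot R) -> periodic R ->
    (forall A : 'M[R]_n, (forall i j, jacobson R (A i j)) -> exists N, A ^+ N = 0) ->
  periodic 'M[R]_n.
Proof.
move=> ssS pR nilJ A; pose S := jquot R.
have pS : periodic S.
  move=> a; have [x <-] := jproj_surj a; have [m [k [m0 k0 mk E]]] := pR x.
  by exists m, k; split=> //; rewrite -!rmorphXn E.
have lS : locally_finite [set: 'M[S]_n].
  apply: locally_finite_mx; first exact: periodic_exponent.
  exact: semisimple_periodic_locally_finite.
have pA : periodic 'M[S]_n := locally_finite_periodic lS.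
have [k [m [_ km E]]] := periodic_ltn (map_mx (@jproj R) A) pA.
have [|N AN] := nilJ (A ^+ m - A ^+ k).
  move=> i j; rewrite !mxE; apply/jproj_eq.
  have /(congr1 (fun B : 'M_n => B i j)) := E.
  by rewrite -!rmorphXn !mxE.
apply: periodic_of_nilpotent_sub km AN.
by apply: finite_exponent_mx; apply: periodic_exponent.
Qed.

Theorem theorem2p10 (R : pzRingType) (n : nat) :
  (0 < n)%N ->
  right_perfect R \/ left_perfect R ->
  periodic R ->
  periodic 'M[R]_n.
Proof.
move=> _ [] [ssR tR] pR; apply: periodic_mx_of_nil_jacobson => // A.
  exact: right_T_nilpotent_mx.
exact: left_T_nilpotent_mx.
Qed.
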